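(* Let $R$ be a weakly Laskerian ring and $I$ a proper ideal of $R$. Assume that either (i) the Krull dimension $\dim R$ is finite; or (ii) the polynomial ring $R[X]$ is weakly Laskerian for some indeterminate $X$ over $R$. Then $\operatorname{Min} I\subseteq \mathrm{ZS}(I)$.
   Context: All rings are commutative with identity. For an $R$-module $M$, $\operatorname{Ass}_R M$ denotes the set of prime ideals $\mathfrak p$ of $R$ of the form $\mathfrak p=(0:_R x)$ for some $x\in M$. An $R$-module $M$ is weakly Laskerian if $\operatorname{Ass}_R(M/N)$ is a finite set for every submodule $N$ of $M$. A ring is weakly Laskerian if it is weakly Laskerian as a module over itself. For a proper ideal $I$ of $R$, $\operatorname{Min} I$ denotes the set of prime ideals minimal among those containing $I$. A prime ideal $\mathfrak p$ is an associated prime of $I$ in the Zariski-Samuel sense if $\mathfrak p=\sqrt{I:_R x}$ for some $x\in R$, where $I:_R x=\{r\in R \mid rx\in I\}$; $\mathrm{ZS}(I)$ denotes the set of Zariski-Samuel associated primes of $I$. *)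

(* Defs.v *)
From HB Require Import structures.
From mathcomp Require Import all_boot all_order all_algebra.
From mathcomp Require Import generic_quotient ring_quotient.
From mathcomp Require Import boolp classical_sets functions cardinality.

Set Implicit Arguments.
Unset Strict Implicit.
Unset Printing Implicit Defensive.

Import GRing.Theory.

Local Open Scope ring_scope.
Local Open Scope quotient_scope.
Local Open Scope classical_set_scope.

Section QuotientModule.
Variables (R : pzRingType) (M : lmodType R) (N : submodClosed M).

(* The library's [submodClosed] structure does not inherit from [zmodClosed],
   although over a ring stability under opposites follows from stability
   under scaling by -1. *)
Lemma submod_zmod_closed : zmod_closed N.
Proof. exact: GRing.submod_closedB (submodClosedP N). Qed.

Definition submod_zmod : zmodClosed M :=
  HB.pack ((N : {pred M}) : M -> bool)
    (GRing.isZmodClosed.Build M (N : {pred M}) submod_zmod_closed).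

Definition quotmod : Type := Quotient.quot submod_zmod.

HB.instance Definition _ := GRing.Zmodule.on quotmod.
HB.instance Definition _ := EqQuotient.on quotmod.

Definition quotmod_scale (a : R) (x : quotmod) : quotmod :=
  \pi_quotmod (a *: repr x).

Lemma pi_quotmodE (x y : M) :
  (\pi_quotmod x = \pi_quotmod y) <-> (x - y \in N).
Proof.
have E := @Quotient.idealrBE M submod_zmod x y.
by split=> [/eqP xy|xy]; [move: E; rewrite xy | apply/eqP; rewrite -E].
Qed.

Lemma pi_quotmodZ (a : R) (x : M) :
  \pi_quotmod (a *: x) = quotmod_scale a (\pi_quotmod x).
Proof.
apply/pi_quotmodE; rewrite -scalerBr rpredZ //.
by apply/pi_quotmodE; rewrite reprK.
Qed.

Lemma pi_quotmodD (x y : M) :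
  \pi_quotmod (x + y) = \pi_quotmod x + \pi_quotmod y.
Proof. by rewrite [LHS](@Quotient.pi_add M submod_zmod). Qed.

Lemma quotmod_scaleA a b x :
  quotmod_scale a (quotmod_scale b x) = quotmod_scale (a * b) x.
Proof.
rewrite -[x]reprK -(pi_quotmodZ b) -(pi_quotmodZ a) -(pi_quotmodZ (a * b)).
by rewrite scalerA.
Qed.

Lemma quotmod_scale1 : left_id 1 quotmod_scale.
Proof. by move=> x; rewrite -[x]reprK -pi_quotmodZ scale1r. Qed.

Lemma quotmod_scaleDr : right_distributive quotmod_scale +%R.
Proof.
move=> a x y; rewrite -[x]reprK -[y]reprK -pi_quotmodD -!pi_quotmodZ.
by rewrite scalerDr pi_quotmodD.
Qed.

Lemma quotmod_scaleDl x : {morph quotmod_scale^~ x : a b / a + b}.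
Proof.
by move=> a b; rewrite -[x]reprK -!pi_quotmodZ scalerDl pi_quotmodD.
Qed.

HB.instance Definition _ := GRing.Zmodule_isLmodule.Build R quotmod
  quotmod_scaleA quotmod_scale1 quotmod_scaleDr quotmod_scaleDl.

End QuotientModule.

Section Ideals.
Variable R : comNzRingType.
Implicit Types I J p q : set R.

(* The library's [idealr_closed] already requires that 1 is not a member, so
   both predicates below describe ideals different from R. *)
Definition is_proper_ideal I : Prop := idealr_closed (mem I).

Definition is_prime_ideal p : Prop :=
  is_proper_ideal p /\ prime_idealr_closed (mem p).

Definition radical J : set R := [set r | exists2 n, (0 < n)%N & J (r ^+ n)].

Definition colon I (x : R) : set R := [set r | I (r * x)].

Definition minimal_primes I : set (set R) :=
  [set p | [/\ is_prime_ideal p, I `<=` p &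
    forall q, is_prime_ideal q -> I `<=` q -> q `<=` p -> q = p]].

Definition ZS I : set (set R) :=
  [set p | is_prime_ideal p /\ exists x : R, p = radical (colon I x)].

End Ideals.

Definition ann (R : comNzRingType) (M : lmodType R) (x : M) : set R :=
  [set r | r *: x = 0].

Definition Ass (R : comNzRingType) (M : lmodType R) : set (set R) :=
  [set p | is_prime_ideal p /\ exists x : M, p = ann x].

Definition weakly_Laskerian (R : comNzRingType) (M : lmodType R) : Prop :=
  forall N : submodClosed M, finite_set (Ass (quotmod N)).

Definition weakly_Laskerian_ring (R : comNzRingType) : Prop :=
  weakly_Laskerian R^o.

(* Only the values p 0, ..., p n matter: the chain p 0 < ... < p n has
   length n. *)
Definition prime_chain (R : comNzRingType) (n : nat) (p : nat -> set R) : Prop :=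
  (forall i, (i <= n)%N -> is_prime_ideal (p i)) /\
  (forall i, (i < n)%N -> p i `<` p i.+1).

Definition finite_krull_dim (R : comNzRingType) : Prop :=
  exists d : nat, forall (n : nat) (p : nat -> set R),
    prime_chain n p -> (n <= d)%N.

(* Main.v *)
Require Import Defs.
From HB Require Import structures.
From mathcomp Require Import all_boot all_order all_algebra.
From mathcomp Require Import generic_quotient ring_quotient.
From mathcomp Require Import boolp classical_sets cardinality.

Set Implicit Arguments.
Unset Strict Implicit.
Unset Printing Implicit Defensive.

Import GRing.Theory.

Local Open Scope ring_scope.
Local Open Scope quotient_scope.
Local Open Scope classical_set_scope.

(** If primes [P_i] and elements [a_i] satisfy [a_i \in P_j] exactly when
    [i <> j], then each [P_i] is the annihilator of [a_i] modulo the
    intersection of all [P_j]; so the spectrum of a weakly Laskerian ring has no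
    infinite discrete subspace. The minimal primes of a set form a Hausdorff
    space, and an infinite Hausdorff space has an infinite discrete subspace, so
    there are finitely many of them. Together with the ascending chain condition
    on primes this makes the spectrum Noetherian: [p] is the radical of
    [I + (F)] for some finite [F]. The generators in [F] being nilpotent in the
    localization of [R/I] at the minimal prime [p], a single [x \notin p] kills
    powers of all of them modulo [I], and [p] is the radical of [I : x].
    The chain condition is clear in finite dimension; a strictly increasing
    sequence of primes of [R] gives an infinite discrete family in the spectrum
    of [R[X]]. *)

(** * Prime ideals, minimal primes and chains of primes *)

Section Primes.
Variable R : comNzRingType.
Implicit Types (J K S p q Q : set R) (x y s : R).

Definition ideal J := J 0 /\ forall a x y, J x -> J y -> J (a * x + y).

Definition rad_primes J : set R :=
  [set x | forall q, is_prime_ideal q -> J `<=` q -> q x].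

Definition acc_primes := forall P : nat -> set R,
  (forall i, is_prime_ideal (P i)) -> ~ (forall i, P i `<` P i.+1).

Lemma prime_idealP p : is_prime_ideal p <->
  [/\ ideal p, ~ p 1 & forall x y, p (x * y) -> p x \/ p y].
Proof.
split=> [[[p0 p1 pD] pM]|[[p0 pD] p1 pM]].
  split.
  - split=> [|a x y /mem_set px /mem_set py]; first exact: set_mem p0.
    exact/set_mem/pD.
  - by move=> /mem_set p1'; rewrite p1' in p1.
  - move=> x y /mem_set /pM /orP[] /set_mem ?; [by left|by right].
split; first split.
- exact/mem_set.
- by apply/negP => /set_mem.
- move=> a x y /set_mem px /set_mem py; exact/mem_set/pD.
- move=> x y /set_mem /pM[] /mem_set xy; apply/orP; by [left|right].
Qed.

Lemma proper_ideal_ideal J : is_proper_ideal J -> ideal J.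
Proof.
case=> J0 _ JD; split=> [|a x y /mem_set Jx /mem_set Jy].
  exact: set_mem J0.
exact/set_mem/JD.
Qed.

Lemma prime_ideal_ideal p : is_prime_ideal p -> ideal p.
Proof. by move=> /prime_idealP[]. Qed.

Lemma prime1 p : is_prime_ideal p -> ~ p 1.
Proof. by move=> /prime_idealP[]. Qed.

Lemma primeM p x y : is_prime_ideal p -> p (x * y) -> p x \/ p y.
Proof. by move=> /prime_idealP[_ _]; apply. Qed.

Lemma primeX p x n : is_prime_ideal p -> p (x ^+ n) -> p x.
Proof.
move=> pp; elim: n => [|n IH]; first by rewrite expr0 => /(prime1 pp).
by rewrite exprS => /(primeM pp)[].
Qed.

Lemma primeMn p x y : is_prime_ideal p -> ~ p x -> ~ p y -> ~ p (x * y).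
Proof. by move=> pp px py /(primeM pp)[]. Qed.

Lemma idealMl J x y : ideal J -> J y -> J (x * y).
Proof. by case=> J0 JD Jy; rewrite -[x * y]addr0; apply: JD. Qed.

Lemma idealMr J x y : ideal J -> J x -> J (x * y).
Proof. by rewrite mulrC; apply: idealMl. Qed.

Lemma idealD J x y : ideal J -> J x -> J y -> J (x + y).
Proof. by case=> J0 JD Jx Jy; rewrite -[x]mul1r; apply: JD. Qed.

Lemma ideal_bigcap T (D : set T) (F : T -> set R) :
  (forall i, D i -> ideal (F i)) -> ideal (\bigcap_(i in D) F i).
Proof.
move=> FI; split=> [i Di|a x y xF yF i Di]; first by case: (FI i Di).
by case: (FI i Di) => _; apply; [apply: xF|apply: yF].
Qed.

(** An ideal above [J] that is maximal among those disjoint from [S] is prime. *)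
Lemma exists_prime_avoiding J S : ideal J -> S 1 ->
  (forall x y, S x -> S y -> S (x * y)) -> J `&` S = set0 ->
  exists Q, [/\ is_prime_ideal Q, J `<=` Q & Q `&` S = set0].
Proof.
move=> Jid S1 SM JS.
pose good K := ideal K /\ forall x, K x -> ~ S x.
(* The chain may be empty, so Zorn's lemma runs over the part [A] added to [J]. *)
have [F FP Ftot|A [[Aid AS] Amax]] := @Zorn_bigcup R (fun A => good (J `|` A)).
  split=> [|x [Jx|[A /FP[_ AS] Ax]] Sx]; last 2 first.
  - by have : (J `&` S) x by []; rewrite JS.
  - by apply: (AS x) => //; right.
  split=> [|a x y]; first by left; case: Jid.
  have chain C : F C -> (J `|` C) x -> (J `|` C) y ->
      (J `|` \bigcup_(A in F) A) (a * x + y).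
    move=> FC Cx Cy; have [[_ CD] _] := FP _ FC.
    by case: (CD a x y Cx Cy) => ?; [left|right; exists C].
  move=> [Jx|[A FA Ax]] [Jy|[B FB By]].
  - by left; case: Jid => _; apply.
  - by apply: (chain B) => //; [left|right].
  - by apply: (chain A) => //; [right|left].
  - by case: (Ftot A B FA FB) => AB; [apply: (chain B)|apply: (chain A)] => //;
      right=> //; apply: AB.
set Q := J `|` A in Aid AS.
pose ext x : set R := [set z | exists a u, Q u /\ z = a * x + u].
have QE x : Q `<=` ext x by move=> u Qu; exists 0, u; rewrite mul0r add0r.
have extx x : ext x x by exists 1, 0; rewrite mul1r addr0; case: Aid.
have ext_ideal x : ideal (ext x).
  split=> [|a _ _ [b [u [Qu ->]]] [c [r [Qr ->]]]]; first by apply: QE; case: Aid.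
  exists (a * b + c), (a * u + r); split; first by case: Aid => _; apply.
  by rewrite mulrDr mulrDl mulrA addrACA.
have extS x : ~ Q x -> exists2 z, S z & ext x z.
  move=> Qx; apply: contrapT => nS; apply: (Amax (ext x)).
    split=> [y Ay|AE]; first by apply: QE; right.
    by apply: Qx; right; apply: AE.
  have -> : J `|` ext x = ext x.
    by rewrite setUidr // => y Jy; apply: QE; left.
  by split=> // z xz Sz; apply: nS; exists z.
exists Q; split; [|by move=> ?; left|]; last first.
  by rewrite -subset0 => x [/AS].
apply/prime_idealP; split=> //; first by move=> /AS.
(* Both [Q + (x)] and [Q + (y)] meet [S], and their product lies in [Q]. *)
move=> x y Qxy; apply: contrapT => /not_orP[/extS[s Ss [a [u [Qu sE]]]]].
move=> /extS[t St [b [r [Qr tE]]]]; apply: (AS (s * t)); last exact: SM.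
have -> : s * t = (a * b) * (x * y) + (u * t + r * (a * x)).
  by rewrite sE tE !(mulrDl, mulrDr) mulrACA -addrA addrCA addrC -!addrA;
     rewrite [a * x * r]mulrC.
by apply: idealD (idealMl _ Aid Qxy) _ => //; apply: idealD => //; apply: idealMr.
Qed.

Lemma exists_minimal_prime J q : is_prime_ideal q -> J `<=` q ->
  exists2 p, minimal_primes J p & p `<=` q.
Proof.
move=> qp Jq.
pose good K := is_prime_ideal K /\ J `<=` K.
(* Zorn's lemma yields maximal sets, so it runs over the part [A] removed from [q]; the empty chain
   gives [q]. *)
have [F FP Ftot|A [[Ap AJ] Amax]] := @Zorn_bigcup R (fun A => good (q `\` A)).
  have qE x : (q `\` \bigcup_(A in F) A) x <-> q x /\ forall A, F A -> (q `\` A) x.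
    split=> [[qx nF]|[qx xF]].
      by split=> // A FA; split=> // Ax; apply: nF; exists A.
    by split=> // -[A FA Ax]; case: (xF A FA).
  split; last first.
    by move=> x Jx; apply/qE; split; [exact: Jq|move=> A /FP[_]; apply].
  apply/prime_idealP; split.
  - split=> [|a x y /qE[qx xF] /qE[qy yF]]; apply/qE; split.
    + by case: (prime_ideal_ideal qp).
    + by move=> A /FP[/prime_ideal_ideal[]].
    + by case: (prime_ideal_ideal qp) => _; apply.
    + move=> A FA; have [/prime_ideal_ideal[_ AD] _] := FP A FA.
      by apply: AD; [apply: xF|apply: yF].
  - by move=> /qE[/(prime1 qp)].
  - move=> x y /qE[qxy xyF]; apply: contrapT => /not_orP[nx ny].
    have wit z : ~ (q `\` \bigcup_(A in F) A) z ->
        ~ q z \/ exists2 A, F A & ~ (q `\` A) z.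
      move=> nz; apply: contrapT => /not_orP[/contrapT qz nA]; apply: nz.
      by apply/qE; split=> // A FA; apply: contrapT => ?; apply: nA; exists A.
    have qq : F !=set0 -> forall z, ~ q z -> exists2 A, F A & ~ (q `\` A) z.
      by move=> [A FA] z nz; exists A => // -[].
    have F0 : F !=set0.
      have [qx|qy] := primeM qp qxy.
        by have [|[A FA _]] := wit _ nx => //; exists A.
      by have [|[A FA _]] := wit _ ny => //; exists A.
    have {nx}[A FA Ax] : exists2 A, F A & ~ (q `\` A) x.
      by have [/(qq F0)|] := wit _ nx.
    have {ny}[B FB By] : exists2 A, F A & ~ (q `\` A) y.
      by have [/(qq F0)|] := wit _ ny.
    have [C FC [Cx Cy]] : exists2 C, F C & ~ (q `\` C) x /\ ~ (q `\` C) y.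
      case: (Ftot A B FA FB) => AB; [exists B|exists A] => //; split=> //.
        by apply: contra_not Ax => -[? nB]; split=> // /AB.
      by apply: contra_not By => -[? nA]; split=> // /AB.
    have [Cp _] := FP C FC.
    by have [] := primeM Cp (xyF C FC).
exists (q `\` A); last by move=> x [].
split=> // p pp Jp pA; apply/seteqP; split=> //.
apply: contrapT => /existsNP[x /not_implyP[[qx Ax] px]].
have pE : q `\` (q `\` p) = p.
  by rewrite setDD; apply/setIidPr => y /pA[].
(* A prime [p] strictly below the one found would let [A] grow by the elements of [q] outside
   [p]. *)
apply: (Amax (A `|` (q `\` p))); last first.
  suff -> : q `\` (A `|` (q `\` p)) = p by split.
  by rewrite setDUr pE; apply/setIidPr.
split=> [y ?|/(_ x) Ax']; first by left.
by apply/Ax/Ax'; right.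
Qed.

Lemma rad_primes_ideal J : ideal (rad_primes J).
Proof.
split=> [|a x y Jx Jy] q qp Jq; first by case: (prime_ideal_ideal qp).
by case: (prime_ideal_ideal qp) => _; apply; [apply: Jx|apply: Jy].
Qed.

(** [rad_primes J] is an ideal for any set [J], as [minimal_prime_nilpotent] requires. *)
Lemma minimal_primes_rad J : minimal_primes J `<=` minimal_primes (rad_primes J).
Proof.
have Jrad : J `<=` rad_primes J by move=> x Jx q _; apply.
move=> p [pp Jp pmin]; split=> // [x|q qp Jq]; first by apply.
exact/pmin/(subset_trans Jrad).
Qed.

(* This is the nilpotency of the elements of [p] in the localization at [p] of
   the ring modulo [J]. *)
Lemma minimal_prime_nilpotent J p x : ideal J -> minimal_primes J p -> p x ->
  exists s n, ~ p s /\ J (s * x ^+ n).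
Proof.
move=> Jid [pp Jp pmin] px; apply: contrapT => nsn.
(* A prime above [J] avoiding [S] lies in [p] and omits [x], against minimality. *)
pose S : set R := [set z | exists s n, ~ p s /\ z = s * x ^+ n].
have [||||Q [Qp JQ QS]] := @exists_prime_avoiding J S.
- exact: Jid.
- by exists 1, 0%N; rewrite expr0 mulr1; split=> //; apply: prime1.
- move=> _ _ [s [n [ps ->]]] [t [m [pt ->]]]; exists (s * t), (n + m)%N.
  by split; [exact: primeMn|rewrite exprD mulrACA].
- rewrite -subset0 => z [Jz [s [n [ps zE]]]]; apply: nsn.
  by exists s, n; rewrite -zE.
have nQS z : S z -> ~ Q z.
  by move=> Sz Qz; suff : (Q `&` S) z by rewrite QS.
have Qx : ~ Q x.
  by apply: nQS; exists 1, 1%N; rewrite mul1r expr1; split=> //; apply: prime1.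
suff QE : Q = p by apply: Qx; rewrite QE.
apply: pmin => // z Qz; apply: contrapT => pz; apply: nQS Qz.
by exists z, 0%N; rewrite expr0 mulr1.
Qed.

Lemma minimal_prime_sub J p q : minimal_primes J p -> minimal_primes J q ->
  p `<=` q -> p = q.
Proof. by move=> [pp Jp _] [_ _ qmin] pq; apply: qmin. Qed.

(** Hausdorff property: for [x] in [p] but not in [q], some [s] outside [p] puts [s * x ^+ n] in
    every minimal prime, so [s] and [x] define disjoint neighbourhoods. *)
Lemma minimal_primes_separated J p q :
  minimal_primes J p -> minimal_primes J q -> p <> q ->
  exists s t, [/\ ~ p s, ~ q t &
    forall p', minimal_primes J p' -> p' s \/ p' t].
Proof.
move=> pJ qJ pq.
have /existsNP[x /not_implyP[px qx]] : ~ p `<=` q.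
  by move=> /(minimal_prime_sub pJ qJ).
have [s [n [ps sx]]] := minimal_prime_nilpotent (@rad_primes_ideal J) 
  (minimal_primes_rad pJ) px.
exists s, x; split=> // p' [p'p Jp' _].
by case: (primeM p'p (sx p' p'p Jp')) => [|/(primeX p'p)]; [left|right].
Qed.

(** A prime where [P] fails lies strictly below another one; dependent choice then gives an
    ascending sequence. *)
Lemma acc_primes_ind (P : set R -> Prop) : acc_primes ->
  (forall p, is_prime_ideal p ->
    (forall q, is_prime_ideal q -> p `<` q -> P q) -> P p) ->
  forall p, is_prime_ideal p -> P p.
Proof.
move=> acc IH p pp; apply: contrapT => nP.
pose T := {q | is_prime_ideal q /\ ~ P q}.
have next (q : T) : {q' : T | sval q `<` sval q'}.
  apply: cid; apply: contrapT => nq; case: q nq => q [qp nPq] nq.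
  apply/nPq/IH => // q' q'p qq'; apply: contrapT => nPq'; apply: nq.
  by exists (exist _ q' (conj q'p nPq')).
have [f [_ fS]] := dependent_choice next (exist _ p (conj pp nP)).
by apply: (acc (fun i => sval (f i))) => // i; case: (f i) => q [].
Qed.

Lemma finite_krull_dim_acc : finite_krull_dim R -> acc_primes.
Proof.
move=> [d dP] P Pp Pc; have : prime_chain d.+1 P by split=> i _.
by move=> /dP; rewrite ltnn.
Qed.

End Primes.

(** * Finiteness in the spectrum of a weakly Laskerian ring *)

Section WeaklyLaskerian.
Variable R : comNzRingType.
Hypothesis wlR : weakly_Laskerian_ring R.

Section IdealSubmodule.
Variables (J : set R) (Jid : ideal J).

Lemma ideal_submod_closed : GRing.subsemimod_closed (mem J : {pred R^o}).
Proof.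
case: Jid => J0 JD; split; first split.
- exact/mem_set.
- by move=> x y /set_mem Jx /set_mem Jy; apply/mem_set/(idealD Jid Jx Jy).
- by move=> a x /set_mem Jx; apply/mem_set/(idealMl a Jid Jx).
Qed.

Definition ideal_submod : submodClosed R^o :=
  HB.pack ((fun x => x \in J) : R^o -> bool)
    (GRing.isSubmodClosed.Build R R^o (fun x => x \in J) ideal_submod_closed).

Lemma ann_quotmod_ideal (a : R) :
  ann (\pi_(quotmod ideal_submod) (a : R^o)) = [set r | J (r * a)].
Proof.
have E r : r *: \pi_(quotmod ideal_submod) (a : R^o) = 0 <-> J (r * a).
  have -> : 0 = \pi_(quotmod ideal_submod) (0 : R^o).
    by rewrite -[LHS](scale0r (\pi_(quotmod ideal_submod) (0 : R^o)))
      -[LHS]pi_quotmodZ scale0r.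
  have -> : r *: \pi_(quotmod ideal_submod) (a : R^o) =
      \pi_(quotmod ideal_submod) (r * a : R^o) by rewrite [RHS]pi_quotmodZ.
  rewrite pi_quotmodE subr0.
  by split=> [/set_mem|] // Jra; apply/mem_set.
by apply/seteqP; split=> r /= /E.
Qed.

End IdealSubmodule.

Lemma no_discrete_primes (P : nat -> set R) (a : nat -> R) :
  (forall i, is_prime_ideal (P i)) -> (forall i, ~ P i (a i)) ->
  (forall i j, i <> j -> P j (a i)) -> False.
Proof.
move=> Pp Pa Pja.
pose J := \bigcap_(i in [set: nat]) P i.
have Jid : ideal J by apply: ideal_bigcap => i _; apply: prime_ideal_ideal.
have PE i : P i = [set r | J (r * a i)].
  apply/seteqP; split=> r /=.
    move=> Pr j _; have [<-|/eqP ij] := eqVneq i j.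
      exact: (idealMr _ (prime_ideal_ideal (Pp i)) Pr).
    exact: (idealMl _ (prime_ideal_ideal (Pp j)) (Pja i j ij)).
  by move=> /(_ i I) /(primeM (Pp i))[|/Pa].
have Pinj : injective P.
  move=> i j Pij; apply: contrapT => ij.
  by apply: (Pa i); rewrite Pij; apply: Pja.
(* The [P i] are infinitely many associated primes of the ring modulo [J]. *)
apply: infinite_nat.
rewrite -(eq_finite_set (inj_card_eq (in2W Pinj))).
apply: sub_finite_set (wlR (ideal_submod Jid)) => _ [i _ <-]; split=> //.
by exists (\pi_(quotmod (ideal_submod Jid)) (a i : R^o)); rewrite ann_quotmod_ideal.
Qed.

(* Multiplying [a i] by an element of each [P j `\` P i] with [j < i] makes the
   family discrete. *)
Lemma no_right_discrete_primes (P : nat -> set R) (a : nat -> R) :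
  (forall i, is_prime_ideal (P i)) -> (forall i, ~ P i (a i)) ->
  (forall i j, (i < j)%N -> P j (a i)) ->
  ~ (forall i j, (j < i)%N -> ~ P j `<=` P i).
Proof.
move=> Pp Pa Paj Pn.
have /choice[t tP] (ij : nat * nat) : exists r, (ij.2 < ij.1)%N ->
    P ij.2 r /\ ~ P ij.1 r.
  case: ij => i j /=; have [ji|_] := boolP (j < i)%N; last by exists 0.
  by have /existsNP[r /not_implyP[]] := Pn i j ji; exists r.
apply: (@no_discrete_primes P (fun i => a i * \prod_(j < i) t (i, j : nat))) => //.
- move=> i; apply: primeMn => //.
  elim/big_ind: _ => [|x y|j _]; [exact: prime1|exact: primeMn|].
  by case: (tP (i, j : nat) (ltn_ord j)).
- move=> i j /eqP; rewrite neq_ltn => /orP[ij|ji].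
    exact: (idealMr _ (prime_ideal_ideal (Pp j)) (Paj i j ij)).
  rewrite (bigD1 (Ordinal ji)) //=; have Pj := prime_ideal_ideal (Pp j).
  by apply/(idealMl _ Pj)/(idealMr _ Pj); case: (tP (i, j) ji).
Qed.

(* If [p] and [q] are separated by [s] and [t], one of [s], [t] belongs to
   infinitely many of the primes at hand; keep only those and iterate. *)
Lemma finite_minimal_primes (J : set R) : finite_set (minimal_primes J).
Proof.
apply: contrapT => Jinf.
pose inf X := infinite_set X /\ X `<=` minimal_primes J.
pose T := {X : set (set R) | inf X}.
(* [Y] holds a prime of [X], an element outside it, and the infinite set of primes of [X] containing
   that element. *)
pose good (X : T) (Y : (set R * R) * T) := [/\ sval X Y.1.1, ~ Y.1.1 Y.1.2 &
  sval Y.2 = sval X `&` [set p | p Y.1.2]].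
have /choice[f fP] X : exists Y, good X Y.
  case: X => X [Xinf XJ].
  suff [p [a [Xp pa Xa]]] : exists p a, [/\ X p, ~ p a &
      infinite_set (X `&` [set p | p a])].
    have XaP : X `&` [set p | p a] `<=` minimal_primes J by move=> q [/XJ].
    by exists ((p, a), exist inf _ (conj Xa XaP)).
  have [p Xp] := infinite_setN0 Xinf.
  have [q [Xq qp]] := infinite_setN0 (infinite_setD Xinf (finite_set1 p)).
  have {}qp : p <> q by move=> pq; apply: qp; rewrite pq.
  have [s [t [ps qt st]]] := minimal_primes_separated (XJ _ Xp) (XJ _ Xq) qp.
  apply: contrapT => nX; apply: Xinf.
  have XE : X `<=` (X `&` [set p | p s]) `|` (X `&` [set p | p t]).
    by move=> r Xr; case: (st r (XJ _ Xr)) => ?; [left|right].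
  apply: sub_finite_set XE _; rewrite finite_setU; split; apply: contrapT => ?.
    by apply: nX; exists p, s.
  by apply: nX; exists q, t.
pose X i := iter i (fun X => (f X).2)
  (exist inf _ (conj Jinf (@subset_refl _ (minimal_primes J)))).
pose P i := (f (X i)).1.1; pose a i := (f (X i)).1.2.
have XS i : sval (X i.+1) = sval (X i) `&` [set p | p (a i)].
  by have [] := fP (X i).
have XP i : sval (X i) (P i) by have [] := fP (X i).
have Xmono i j : (i <= j)%N -> sval (X j) `<=` sval (X i).
  elim: j => [|j IH]; first by rewrite leqn0 => /eqP ->.
  rewrite leq_eqVlt => /orP[/eqP -> //|/IH XX].
  by rewrite XS => p [/XX].
have PJ i : minimal_primes J (P i) by case: (X i) (XP i) => Y [_ YJ] /YJ.
have Paj i j : (i < j)%N -> P j (a i).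
  by move=> ij; have := Xmono _ _ ij _ (XP j); rewrite XS => -[].
have Pa i : ~ P i (a i) by have [] := fP (X i).
apply: (@no_right_discrete_primes P a) => // [i|i j ji PP].
  by have [] := PJ i.
have PE := minimal_prime_sub (PJ j) (PJ i) PP.
by apply: (Pa j); rewrite PE; apply: Paj.
Qed.

(** For an ideal [J]: [A] lies in the radical of [J + (F)] for a finite [F] in [A], the radical
    being expressed through primes. *)
Definition radically_finite (A J : set R) := exists F : seq R,
  [set` F] `<=` A /\
  forall Q, is_prime_ideal Q -> J `<=` Q -> [set` F] `<=` Q -> A `<=` Q.

(** A prime above [J] contains one of the finitely many minimal primes of [J], so their finite sets
    can be concatenated. *)
Lemma radically_finite_minimal (A J : set R) :
  (forall p, minimal_primes J p -> radically_finite A p) ->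
  radically_finite A J.
Proof.
move=> radA; have /choice[F FP] p : exists F : seq R, minimal_primes J p ->
    [set` F] `<=` A /\ forall Q, is_prime_ideal Q ->
      p `<=` Q -> [set` F] `<=` Q -> A `<=` Q.
  have [/radA[G GP]|nJ] := pselect (minimal_primes J p); first by exists G.
  by exists [::].
have /(@finite_seqP {classic set R})[M JM] := finite_minimal_primes J.
exists (flatten [seq F p | p <- M]); split.
  move=> x /= /flatten_mapP[p pM]; apply: (FP p _).1.
  by rewrite JM.
move=> Q Qp JQ FQ; have [p pJ pQ] := exists_minimal_prime Qp JQ.
apply: (FP p pJ).2 => // x Fx; apply: FQ; apply/flatten_mapP; exists p => //.
by move: pJ; rewrite JM.
Qed.

(* Noetherian induction on a prime [q]: if [x \in A `\` q], every prime above
   [q] and [x] lies above one of the finitely many minimal primes of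
   [q `|` [set x]], all of which are larger than [q]. *)
Lemma acc_primes_radically_finite (A J : set R) :
  acc_primes R -> radically_finite A J.
Proof.
move=> acc; suff rad q : is_prime_ideal q -> radically_finite A q.
  by apply: radically_finite_minimal => p [/rad].
move: q; apply: acc_primes_ind => // q qp IH.
have [Aq|/existsNP[x /not_implyP[Ax qx]]] := pselect (A `<=` q).
  by exists [::]; split=> // Q _ qQ _; apply: subset_trans qQ.
have [p [pp qxp _]|F [FA FP]] := @radically_finite_minimal A (q `|` [set x]).
  apply: IH => //; split=> [y qy|/(_ x) pq]; first by apply: qxp; left.
  by apply/qx/pq/qxp; right.
exists (x :: F); split=> [y /=|Q Qp qQ FQ].
  by rewrite inE => /orP[/eqP ->//|/FA].
apply: FP => // [y [/qQ//|->]|y Fy]; apply: FQ; first exact: mem_head.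
by rewrite /= inE Fy orbT.
Qed.

End WeaklyLaskerian.

(** * Chains of primes and the polynomial ring *)

Section PolynomialRing.
Variable R : comNzRingType.
Hypothesis wlRX : weakly_Laskerian_ring {poly R}.

(** For a prime [p] this is the ideal [p + ('X - c)]. *)
Definition eval_prime (p : set R) (c : R) : set {poly R} := [set g | p g.[c]].

Lemma eval_prime_prime p c : is_prime_ideal p -> is_prime_ideal (eval_prime p c).
Proof.
move=> pp; apply/prime_idealP; rewrite /eval_prime; split=> /=.
- split=> [|a x y] /=; first by rewrite horner0; case: (prime_ideal_ideal pp).
  by rewrite hornerD hornerM; case: (prime_ideal_ideal pp) => _; apply.
- by rewrite hornerC; apply: prime1.
- by move=> x y; rewrite hornerM; apply: primeM.
Qed.

(* For a chain of primes [p i] with [c i \in p i.+1 `\` p i], the primes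
   [p i + ('X - c i)] of the polynomial ring form a discrete family. *)
Lemma weakly_Laskerian_poly_acc : acc_primes R.
Proof.
move=> p pp pS.
have /choice[c cP] i : exists c, p i.+1 c /\ ~ p i c.
  have [_ /existsNP[x /not_implyP[]]] := pS i.
  by exists x.
have pmono i j : (i <= j)%N -> p i `<=` p j.
  elim: j => [|j IH]; first by rewrite leqn0 => /eqP ->.
  rewrite leq_eqVlt => /orP[/eqP -> //|/IH pij].
  by apply: subset_trans pij _; have [] := pS j.
apply: (@no_right_discrete_primes _ wlRX
  (fun i => eval_prime (p i) (c i)) (fun i => (c i)%:P)).
- by move=> i; apply: eval_prime_prime.
- by move=> i; rewrite /eval_prime /= hornerC; have [] := cP i.
- move=> i j ij; rewrite /eval_prime /= hornerC.
  by apply: (pmono _ _ ij); have [] := cP i.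
(* ['X - c j] vanishes at [c j]; in the [i]-th prime it would put [c i - c j], hence [c i], in
   [p i]. *)
- move=> i j ji /(_ ('X - (c j)%:P)); rewrite /eval_prime /= !hornerE subrr.
  have pid := prime_ideal_ideal (pp i).
  have pc : p i (c j) by apply: (pmono _ _ ji); have [] := cP j.
  case: (cP i) => _ pci /(_ (prime_ideal_ideal (pp j)).1) pcc.
  by apply: pci; rewrite -[c i](subrK (c j)); apply: idealD.
Qed.

End PolynomialRing.

(** * Minimal primes as radicals of colon ideals *)

Lemma acc_minimal_primes_ZS (R : comNzRingType) (I : set R) :
  weakly_Laskerian_ring R -> acc_primes R -> ideal I ->
  minimal_primes I `<=` ZS I.
Proof.
move=> wlR acc Iid p pI; have [pp Ip pmin] := pI; split=> //.
have [F [Fp FP]] := acc_primes_radically_finite wlR p I acc.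
have [x [px xF]] : exists x, ~ p x /\
    forall r, r \in F -> exists n, I (x * r ^+ n).
  elim: F Fp {FP} => [_|r F IH rFp]; first by exists 1; split=> //; apply: prime1.
  have [|x [px xF]] := IH.
    by move=> y Fy; apply: rFp; rewrite /= inE Fy orbT.
  have [s [n [ps sr]]] := minimal_prime_nilpotent Iid pI (rFp r (mem_head r F)).
  exists (s * x); split; first exact: primeMn.
  move=> y; rewrite inE => /orP[/eqP ->|/xF[m xy]].
    by exists n; rewrite mulrAC; apply: idealMr.
  by exists m; rewrite -mulrA; apply: idealMl.
exists x; apply/seteqP; split=> r; last first.
  by move=> [n _ /Ip/(primeM pp)[/(primeX pp)|/px]].
move=> pr; apply: contrapT => nr.
have colid : ideal (colon I x).
  split=> [|a y z]; rewrite /colon /= ?mul0r; first by case: Iid.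
  by move=> Iy Iz; rewrite mulrDl -mulrA; case: Iid => _; apply.
(* A prime above [colon I x] avoiding the powers of [r] would contain [F], hence [p] and [r]. *)
have [||||Q [Qp IQ QS]] :=
  @exists_prime_avoiding R (colon I x) [set y | exists n, y = r ^+ n].
- exact: colid.
- by exists 0%N; rewrite expr0.
- by move=> _ _ [n ->] [m ->]; exists (n + m)%N; rewrite exprD.
(* [radical] asks for a positive exponent: if [r ^+ 0] is in the colon ideal, so is [r ^+ 1]. *)
- rewrite -subset0 => y [Iy [[|n] yE]]; apply: nr.
    exists 1%N => //; rewrite /colon /= expr1; apply: (idealMl r Iid).
    by move: Iy; rewrite /colon /= yE expr0 mul1r.
  by exists n.+1 => //; rewrite -yE.
have : (Q `&` [set y | exists n, y = r ^+ n]) r; last by rewrite QS.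
split; last by exists 1%N; rewrite expr1.
apply: FP pr => // [y Iy|y Fy].
  by apply: IQ; rewrite /colon /=; apply: idealMr.
have [n Iyn] := xF y Fy; apply: (primeX (n := n) Qp).
by apply: IQ; rewrite /colon /= mulrC.
Qed.

Theorem corollary2p9 (R : comNzRingType) (I : set R) :
  weakly_Laskerian_ring R ->
  is_proper_ideal I ->
  finite_krull_dim R \/ weakly_Laskerian_ring {poly R} ->
  minimal_primes I `<=` ZS I.
Proof.
move=> wlR Iproper dim_or_poly.
apply: acc_minimal_primes_ZS => //; last exact: proper_ideal_ideal.
by case: dim_or_poly => [/finite_krull_dim_acc|/weakly_Laskerian_poly_acc].
Qed.
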